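(* Let $C_1^3,\dots,C_5^3$ be the nonassociative code loops of rank $3$ with characteristic vectors $\lambda(C_1^3)=(111111)$, $\lambda(C_2^3)=(000000)$, $\lambda(C_3^3)=(000111)$, $\lambda(C_4^3)=(110000)$, $\lambda(C_5^3)=(100000)$. For each $i=1,\dots,5$, the code $V_i$ below is a minimal representation of $C_i^3$, where $V_i$ is regarded as a subspace of $\mathbb{F}_2^{m_i}$ with $m_i$ the largest integer occurring in the listed generators (so $m_1=7$, $m_2=13$, $m_3=11$, $m_4=17$, $m_5=17$), and vectors are identified with subsets of $\{1,\dots,m_i\}$: \begin{align*} V_1&=\langle \{1,2,3,4\},\ \{1,2,5,6\},\ \{1,3,5,7\}\rangle,\\ V_2&=\langle \{1,2,3,4,5,6,7,8\},\ \{1,2,3,4,9,10,11,12\},\ \{1,5,6,7,9,10,11,13\}\rangle,\\ V_3&=\langle \{1,2,3,4,5,6,7,8\},\ \{1,2,3,4,5,6,9,10\},\ \{1,2,3,4,5,7,9,11\}\rangle,\\ V_4&=\langle \{1,2,3,4\},\ \{1,2,5,6,7,8,9,10,11,12,13,14\},\ \{1,3,5,6,7,8,9,10,11,15,16,17\}\rangle,\\ V_5&=\langle \{1,2,3,4,5,6,7,8,9,10,11,12\},\ \{1,2,3,4,5,6,7,8,13,14,15,16\},\ \{1,2,3,4,5,9,10,11,13,14,15,17\}\rangle. \end{align*}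
   Context: Identify $\mathbb{F}_2^m$ with the set of all subsets of $I_m=\{1,\dots,m\}$ (a vector corresponds to its support; addition is symmetric difference), and let $\langle\cdots\rangle$ denote the $\mathbb{F}_2$-linear span. For $v\in\mathbb{F}_2^m$, $|v|$ is the Hamming weight, and $|v\cap w|$, $|v\cap w\cap u|$ are the sizes of the intersections of supports. A doubly even binary code is a subspace $V\subseteq \mathbb{F}_2^m$ with $|v|\equiv 0 \pmod 4$ for all $v\in V$. Code loops. Given a doubly even code $V$, a factor set is a function $\phi:V\times V\to\{1,-1\}$ with $\phi(v,v)=(-1)^{|v|/4}$, $\phi(v,w)=(-1)^{|v\cap w|/2}\phi(w,v)$, $\phi(0,v)=\phi(v,0)=1$, and $\phi(v+w,u)=\phi(v,w+u)\phi(v,w)\phi(w,u)(-1)^{|v\cap w\cap u|}$ for all $u,v,w\in V$. The code loop $L(V)$ is the set $\{1,-1\}\times V$ with, writing $v=(1,v)$ and $-v=(-1,v)$, the product $v\cdot w=\phi(v,w)(v+w)$, $v\cdot(-w)=(-v)\cdot w=-(v\cdot w)$, $(-v)\cdot(-w)=v\cdot w$. It is a Moufang loop, well defined up to isomorphism, and its rank is $\dim_{\mathbb{F}_2}V$. Here $1$ and $-1$ also denote the elements $(1,0)$ and $(-1,0)$ of $L(V)$. All squares, commutators $[x,y]=x^{-1}y^{-1}xy$ and associators $(x,y,z)=((xy)z)(x(yz))^{-1}$ lie in $\{1,-1\}$. Characteristic vectors in rank $3$. A nonassociative code loop $L$ of rank $3$ with generators $a,b,c$ has $(a,b,c)=-1$,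 and its characteristic vector with respect to $a,b,c$ is $\lambda(L)=(\lambda_1\lambda_2\lambda_3\lambda_4\lambda_5\lambda_6)\in\mathbb{F}_2^6$ where $a^2=(-1)^{\lambda_1}$, $b^2=(-1)^{\lambda_2}$, $c^2=(-1)^{\lambda_3}$, $[a,b]=(-1)^{\lambda_4}$, $[a,c]=(-1)^{\lambda_5}$, $[b,c]=(-1)^{\lambda_6}$. ''The code loop with characteristic vector $\lambda$'' means the nonassociative code loop of rank $3$ (unique up to isomorphism) having some generators $a,b,c$ with respect to which its characteristic vector is $\lambda$. Representations. A representation of a code loop $L$ is a doubly even code $V\subseteq\mathbb{F}_2^m$ with $L\cong L(V)$ (isomorphism of loops); $m$ is called the degree of the representation. A representation of $L$ is minimal if its degree is the smallest possible among the representations of $L$. *)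

(* Defs.v *)
From HB Require Import structures.
From mathcomp Require Import all_boot all_order all_algebra.

Set Implicit Arguments.
Unset Strict Implicit.
Unset Printing Implicit Defensive.

Import GRing.Theory.
Local Open Scope ring_scope.

Section BinaryCodes.
Variable m : nat.
Implicit Type v : 'rV['F_2]_m.

Definition supp v : {set 'I_m} := [set i | v ord0 i != 0].

Definition wt v : nat := #|supp v|.

Definition doubly_even (V : {vspace 'rV['F_2]_m}) : Prop :=
  {in V, forall v, 4 %| wt v}%N.

(* Coordinates are numbered from 1 in s, whereas 'I_m starts at 0. *)
Definition vec_of_subset (s : seq nat) : 'rV['F_2]_m :=
  \row_(i < m) (i.+1 \in s)%:R.

Definition code_span (ss : seq (seq nat)) : {vspace 'rV['F_2]_m} :=
  <<[seq vec_of_subset s | s <- ss]>>%VS.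

End BinaryCodes.

(* The group {1, -1} is represented by (bool, addb): b stands for (-1) ^ b. *)
Record factor_set (m : nat) (V : {vspace 'rV['F_2]_m}) := FactorSet {
  fs_fun :> subvs_of V -> subvs_of V -> bool;
  fs_diag : forall v, fs_fun v v = odd (wt (vsval v) %/ 4);
  fs_comm : forall v w, fs_fun v w =
    odd (#|supp (vsval v) :&: supp (vsval w)| %/ 2) (+) fs_fun w v;
  fs_0l : forall v, fs_fun 0 v = false;
  fs_0r : forall v, fs_fun v 0 = false;
  fs_assoc : forall u v w, fs_fun (v + w) u =
    fs_fun v (w + u) (+) fs_fun v w (+) fs_fun w u (+)
    odd #|supp (vsval v) :&: supp (vsval w) :&: supp (vsval u)|
}.

Record code_loop := CodeLoop {
  cl_degree : nat;
  cl_code : {vspace 'rV['F_2]_cl_degree};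
  cl_even : doubly_even cl_code;
  cl_phi : factor_set cl_code
}.

Definition cl_sort (L : code_loop) : Type := (bool * subvs_of (cl_code L))%type.
Coercion cl_sort : code_loop >-> Sortclass.

Section CodeLoopStructure.
Variable L : code_loop.
Implicit Types x y : cl_sort L.

Definition cl_mul x y : cl_sort L :=
  (x.1 (+) y.1 (+) cl_phi L x.2 y.2, x.2 + y.2).
Definition cl_one : cl_sort L := (false, 0).
Definition cl_inv x : cl_sort L := (x.1 (+) cl_phi L x.2 x.2, x.2).

Lemma cl_mul1g : left_id cl_one cl_mul.
Proof.
by case=> s v; rewrite /cl_mul /= fs_0l add0r addbF.
Qed.

Lemma cl_mulg1 : right_id cl_one cl_mul.
Proof.
by case=> s v; rewrite /cl_mul /= fs_0r addr0 !addbF.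
Qed.

Lemma cl_double (v : subvs_of (cl_code L)) : v + v = 0.
Proof.
apply/eqP; rewrite -mulr2n -scaler_nat.
by rewrite (_ : 2%:R = 0 :> 'F_2) ?scale0r //; apply/val_inj.
Qed.

HB.instance Definition _ := Choice.copy (cl_sort L) (bool * subvs_of (cl_code L))%type.
HB.instance Definition _ := hasMul.Build (cl_sort L) cl_mul.
HB.instance Definition _ :=
  Magma_isUMagma.Build (cl_sort L) cl_mul1g cl_mulg1.
HB.instance Definition _ := hasInv.Build (cl_sort L) cl_inv.

Lemma cl_mulVg x : (x^-1 * x = 1)%g.
Proof.
case: x => s v; congr pair; last exact: cl_double.
by rewrite /= [s (+) _]addbC -(addbA _ s s) addbb addbF addbb.
Qed.

Lemma cl_mulgV x : (x * x^-1 = 1)%g.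
Proof.
case: x => s v; congr pair; last exact: cl_double.
by rewrite /= addbA addbb addFb addbb.
Qed.

Definition cl_neg1 : L := (true, 0).

Definition cl_rank : nat := \dim (cl_code L).

Definition nonassociative : Prop :=
  ~ (forall x y z : L, (x * (y * z) = (x * y) * z)%g).

Definition generators (a b c : L) : Prop :=
  forall S : {pred L}, umagma_closed S ->
    {in S, forall x, (x^-1)%g \in S} ->
    a \in S -> b \in S -> c \in S -> forall x, x \in S.

(* [~ x, y] is x^-1 * (y^-1 * (x * y)); the bracketing is immaterial, as two
   elements of a Moufang loop generate a group. *)
Definition characteristic_vector (a b c : L) (lam : 6.-tuple 'F_2) : Prop :=
  [/\ (a ^+ 2 = cl_neg1 ^+ (lam`_0)%R)%g,
      (b ^+ 2 = cl_neg1 ^+ (lam`_1)%R)%g &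
      (c ^+ 2 = cl_neg1 ^+ (lam`_2)%R)%g] /\
  [/\ ([~ a, b] = cl_neg1 ^+ (lam`_3)%R)%g,
      ([~ a, c] = cl_neg1 ^+ (lam`_4)%R)%g &
      ([~ b, c] = cl_neg1 ^+ (lam`_5)%R)%g].

Definition has_characteristic_vector (lam : 6.-tuple 'F_2) : Prop :=
  [/\ nonassociative, cl_rank = 3%N &
      exists a b c : L, generators a b c /\ characteristic_vector a b c lam].

End CodeLoopStructure.

Definition loop_isomorphic (L L' : code_loop) : Prop :=
  exists2 f : L -> L', bijective f & {morph f : x y / (x * y)%g}.

(* L(V) does not depend on the factor set up to isomorphism. *)
Definition representation (L : code_loop) (m : nat)
    (V : {vspace 'rV['F_2]_m}) : Prop :=
  exists (evenV : doubly_even V) (phi : factor_set V),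
    loop_isomorphic L (CodeLoop evenV phi).

Definition minimal_representation (L : code_loop) (m : nat)
    (V : {vspace 'rV['F_2]_m}) : Prop :=
  representation L V /\
  forall (m' : nat) (V' : {vspace 'rV['F_2]_m'}),
    representation L V' -> (m <= m')%N.

(* V is a minimal representation of "the" code loop with characteristic vector
   lam: such a loop exists, and V is a minimal representation of each of them
   (they are all isomorphic). *)
Definition minimal_representation_of (lam : 6.-tuple 'F_2) (m : nat)
    (V : {vspace 'rV['F_2]_m}) : Prop :=
  (exists L : code_loop, has_characteristic_vector L lam) /\
  forall L : code_loop,
    has_characteristic_vector L lam -> minimal_representation L V.

(* Main.v *)
Require Import Defs.
From Stdlib Require Import Btauto.
From mathcomp Require Import all_boot all_order all_algebra.
From mathcomp Require Import zify.

(**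
Let q(v) be the parity of |v|/4 on a doubly even code V, that is, the sign of
the square of a lift of v to L(V). Inclusion-exclusion on supports gives
|v + w| = |v| + |w| - 2 |v & w|, so the commutator sign of v and w is the
polarization of q, and likewise the associator sign is the second polarization
of q. Hence the four defining relations of a factor set only involve q, and so
does the characteristic vector: relative to generators a, b, c with
(a,b,c) = -1, it lists the coefficients of q as a cubic polynomial in three
coordinates, the coefficient of xyz being 1 ([cubic], [cubic_polar]). A code V
together with vectors a, b, c that span it and on which q is this cubic is
called a frame; a loop has characteristic vector lam exactly when its code has
a frame for lam ([char_vector_frame], [frame_char_vector]).

The loop depends on q only. If an additive bijection between two codes respects
q, the factor sets differ by a symmetric 2-cocycle that vanishes on the
diagonal. Such a cocycle describes an abelian extension of exponent 2, which
splits; so it is a coboundary ([symmetric_cocycle_coboundary]), and correcting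
signs by it makes the bijection of codes an isomorphism of loops
([isometry_isomorphic]). Conversely, every frame carries a factor set, given by
an explicit polynomial ([frame_factor_set]). So to represent the loop it is
enough to exhibit a frame in the given code, which is a finite computation of
weights ([subsets_frame]). For the last two codes the frame is not the listed
generating set, but another basis.

For minimality, an isomorphism preserves squares and the element -1, hence q;
every representation of the loop therefore contains three vectors with the same
values of q ([iso_profile]). The seven weights determine how many coordinates
show each nonzero column (a_i, b_i, c_i): four times this number is the sum of
the four weights of the combinations that see the column minus the sum of the
three other weights. These numbers are nonnegative and their sum is at most the
degree. With the parities of the quarters of the weights prescribed by the
cubic, this is an integer linear program, whose optimum is the stated degree.
*)

Set Implicit Arguments.
Unset Strict Implicit.
Unset Printing Implicit Defensive.

Import GRing.Theory.
Local Open Scope ring_scope.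

(** * Coordinates over the field with two elements *)

Notation coords := (bool * bool * bool)%type.

Definition addc (p p' : coords) : coords :=
  let: (x, y, z) := p in let: (x', y', z') := p' in
  (x (+) x', y (+) y', z (+) z').

Section Char2.
Variable U : lmodType 'F_2.
Implicit Types (u v a b c : U).

Lemma addrr_F2 v : v + v = 0.
Proof.
apply/eqP; rewrite -mulr2n -scaler_nat.
by rewrite (_ : 2%:R = 0 :> 'F_2) ?scale0r //; apply/val_inj.
Qed.

Lemma addrrK_F2 u v : u + v + v = u.
Proof. by rewrite -addrA addrr_F2 addr0. Qed.

Lemma scaleF2 (k : 'F_2) v : k *: v = if k != 0 then v else 0.
Proof.
case: k => [[|[|//]]] ltk.
  by rewrite (_ : Ordinal ltk = 0) ?eqxx ?scale0r //; apply/val_inj.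
by rewrite (_ : Ordinal ltk = 1) ?scale1r //; apply/val_inj.
Qed.

Lemma if_addb (s t : bool) v :
  (if s (+) t then v else 0) = (if s then v else 0) + (if t then v else 0).
Proof. by case: s t => [] []; rewrite ?addrr_F2 ?addr0 ?add0r. Qed.

Definition comb a b c (p : coords) : U :=
  let: (x, y, z) := p in
  (if x then a else 0) + (if y then b else 0) + (if z then c else 0).

Lemma comb0 a b c : comb a b c (false, false, false) = 0.
Proof. by rewrite /= !addr0. Qed.

Lemma combD a b c p p' :
  comb a b c (addc p p') = comb a b c p + comb a b c p'.
Proof.
case: p p' => [[x y] z] [[x' y'] z'] /=.
by rewrite !if_addb (addrACA (if x then a else 0)) [LHS]addrACA.
Qed.

End Char2.

Lemma raddf_comb (U W : lmodType 'F_2) (f : {additive U -> W}) a b c p :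
  f (comb a b c p) = comb (f a) (f b) (f c) p.
Proof.
by case: p => [[x y] z] /=; rewrite !raddfD; case: x y z => [] [] []; rewrite ?raddf0.
Qed.

Lemma mem_comb (U : vectType 'F_2) (V : {vspace U}) a b c p :
  a \in V -> b \in V -> c \in V -> comb a b c p \in V.
Proof.
move=> aV bV cV; case: p => [[x y] z] /=.
by apply: rpredD; [apply: rpredD|]; case: ifP => _ //; apply: rpred0.
Qed.

Lemma span3_comb (U : vectType 'F_2) (a b c v : U) :
  v \in <<[:: a; b; c]>>%VS -> exists p, v = comb a b c p.
Proof.
rewrite !span_cons span_nil addv0.
case/memv_addP=> _ /vlineP[x ->] [_ /memv_addP[_ /vlineP[y ->] [_ /vlineP[z ->] ->]] ->].
by exists (x != 0, y != 0, z != 0); rewrite /= !scaleF2 addrA.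
Qed.

(** * Symmetric cocycles on a vector space over the field with two elements *)

Section Coboundary.
Variables (U : vectType 'F_2) (d : U -> U -> bool).
Hypothesis d_diag : forall u, d u u = false.
Hypothesis d_sym : forall u v, d u v = d v u.
Hypothesis d_0l : forall u, d 0 u = false.
Hypothesis d_cocycle : forall u v w,
  d (v + w) u = d v (w + u) (+) d v w (+) d w u.

(** Induction on the spanning sequence. If e trivializes d on the span W of X and
    g is not in W, each vector of the larger span is w or w + g with w in W, and
    the cochain is extended by e (w + g) = e w + d w g, as if the lift of w + g
    were the product of the lifts of w and g. *)
Lemma symmetric_cocycle_coboundary_span (X : seq U) :
  exists e : U -> bool, {in <<X>>%VS &, forall u v,
    d u v = e u (+) e v (+) e (u + v)}.
Proof.
elim: X => [|g X [e IH]].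
  exists (fun _ => false) => u v; rewrite span_nil !memv0 => /eqP-> /eqP->.
  exact: d_0l.
have [gX|gNX] := boolP (g \in <<X>>%VS).
  exists e => u v; rewrite span_cons.
  suff -> : (<[g]> + <<X>>)%VS = <<X>>%VS by exact: IH.
  by apply/addv_idPr; rewrite -memvE.
have split_g u : u \in <<g :: X>>%VS ->
    exists2 w, w \in <<X>>%VS & u = w \/ u = w + g.
  rewrite span_cons => /memv_addP[_ /vlineP[k ->] [w wX ->]]; exists w => //.
  by rewrite scaleF2; case: ifP => _; [right; rewrite addrC | left; rewrite add0r].
have shiftN u : u \in <<X>>%VS -> u + g \in <<X>>%VS = false.
  by move=> uX; apply/negP; rewrite rpredDl // (negbTE gNX).
have d_gg v : d g (v + g) = d v g.
  have := d_cocycle v g g; rewrite addrr_F2 d_0l d_diag addbF (addrC g) (d_sym g v).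
  by move: (d _ _) (d _ _) => [] [].
pose E u := if u \in <<X>>%VS then e u else e (u + g) (+) d (u + g) g.
have E0 u : u \in <<X>>%VS -> E u = e u by rewrite /E => ->.
have E1 u : u \in <<X>>%VS -> E (u + g) = e u (+) d u g.
  by rewrite /E => uX; rewrite shiftN // addrrK_F2.
exists E => _ _ /split_g[u uX [->|->]] /split_g[v vX [->|->]].
- by rewrite !E0 ?rpredD // IH.
- rewrite addrA E0 // !E1 ?rpredD //.
  have := d_cocycle g u v; rewrite (IH u v) //.
  by move: (d _ _) (d _ _) (d _ _) (e _) (e _) (e _) => [] [] [] [] [] [].
- rewrite (addrAC u) (E0 v) // !E1 ?rpredD // d_sym.
  have := d_cocycle g v u; rewrite (addrC v u) (IH v u) // (addrC v u).
  by move: (d _ _) (d _ _) (d _ _) (e _) (e _) (e _) => [] [] [] [] [] [].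
rewrite (addrACA u) addrr_F2 addr0 (E0 (u + v)) ?rpredD // !E1 //.
have := d_cocycle (v + g) u g; rewrite d_gg (addrC g) addrrK_F2 (IH u v) //.
by move: (d _ _) (d _ _) (d _ _) (e _) (e _) (e _) => [] [] [] [] [] [].
Qed.

Lemma symmetric_cocycle_coboundary :
  exists e : U -> bool, forall u v, d u v = e u (+) e v (+) e (u + v).
Proof.
have [e eP] := symmetric_cocycle_coboundary_span (vbasis fullv).
exists e => u v; apply: eP.
  by rewrite (span_basis (vbasisP _)) memvf.
by rewrite (span_basis (vbasisP _)) memvf.
Qed.

End Coboundary.

(** * Weights and intersections in a doubly even code *)

Section Weights.
Variable m : nat.
Implicit Types (v w u : 'rV['F_2]_m).

Lemma F2_addb (x y : 'F_2) : (x + y != 0) = (x != 0) (+) (y != 0).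
Proof.
by case: x y => [[|[|//]]] ltx [[|[|//]]] lty.
Qed.

Lemma card_suppD_cap v w (A : {set 'I_m}) :
  (#|supp (v + w) :&: A| + 2 * #|supp v :&: supp w :&: A| =
   #|supp v :&: A| + #|supp w :&: A|)%N.
Proof.
have cE (B : {set 'I_m}) : #|B| = (\sum_i (i \in B : nat))%N.
  by rewrite -sum1_card big_mkcond; apply: eq_bigr => i _; case: (i \in B).
rewrite !cE big_distrr /= -!big_split; apply: eq_bigr => i _.
rewrite !inE mxE F2_addb.
by case: (v _ _ != 0); case: (w _ _ != 0); case: (i \in A).
Qed.

Lemma wtD v w : (wt (v + w) + 2 * #|supp v :&: supp w| = wt v + wt w)%N.
Proof. by have := card_suppD_cap v w setT; rewrite !setIT. Qed.

Definition odd_quarter v : bool := odd (wt v %/ 4).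

Variable V : {vspace 'rV['F_2]_m}.
Hypothesis evenV : doubly_even V.

Lemma wt4 v : v \in V -> (4 %| wt v)%N.
Proof. exact: evenV. Qed.

Lemma cap_even v w : v \in V -> w \in V -> ~~ odd #|supp v :&: supp w|.
Proof.
move=> vV wV; have := wtD v w.
have := wt4 vV; have := wt4 wV; have := wt4 (rpredD vV wV : v + w \in V); lia.
Qed.

Lemma cap_half v w : v \in V -> w \in V ->
  odd (#|supp v :&: supp w| %/ 2) = odd_quarter v (+) odd_quarter w (+) odd_quarter (v + w).
Proof.
move=> vV wV; have := wtD v w; rewrite /odd_quarter.
have := wt4 vV; have := wt4 wV; have := wt4 (rpredD vV wV : v + w \in V).
by rewrite -!oddD; lia.
Qed.

Lemma odd_cap3 v w u : v \in V -> w \in V -> u \in V ->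
  odd #|supp v :&: supp w :&: supp u| =
  odd (#|supp v :&: supp u| %/ 2) (+) odd (#|supp w :&: supp u| %/ 2) (+)
  odd (#|supp (v + w) :&: supp u| %/ 2).
Proof.
move=> vV wV uV; have := card_suppD_cap v w (supp u).
have := cap_even vV uV; have := cap_even wV uV.
have := cap_even (rpredD vV wV : v + w \in V) uV.
by rewrite -!oddD; lia.
Qed.

End Weights.

(** * The cubic attached to a characteristic vector *)

Section Cubic.
Implicit Types (lam : 6.-tuple 'F_2) (p : coords) (t : bool).

(** The coefficient t of xyz is kept as a parameter because it is the associator
    sign of the generators, which is only shown to be 1 after q is known to have
    this form. *)
Definition cubic t lam p : bool :=
  let: (x, y, z) := p in
  (lam`_0 != 0) && x (+) (lam`_1 != 0) && y (+) (lam`_2 != 0) && z (+)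
  [&& lam`_3 != 0, x & y] (+) [&& lam`_4 != 0, x & z] (+)
  [&& lam`_5 != 0, y & z] (+) [&& t, x, y & z].

(** A bilinear form whose diagonal is the quadratic part, plus a cubic term. The
    latter is yzx' + xzy' + xyz': on the diagonal it is 3xyz = xyz, and its
    coboundary is the symmetric trilinear form of xyz, the sum of v_i w_j u_k
    over the permutations (i, j, k) of the coordinates. *)
Definition cocycle lam p p' : bool :=
  let: (x, y, z) := p in let: (x', y', z') := p' in
  [&& lam`_0 != 0, x & x'] (+) [&& lam`_1 != 0, y & y'] (+)
  [&& lam`_2 != 0, z & z'] (+) [&& lam`_3 != 0, x & y'] (+)
  [&& lam`_4 != 0, x & z'] (+) [&& lam`_5 != 0, y & z'] (+)
  ([&& y, z & x'] (+) [&& x, z & y'] (+) [&& x, y & z']).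

Definition polar2 (T : Type) (add : T -> T -> T) (q : T -> bool) u v : bool :=
  q u (+) q v (+) q (add u v).

(** The polarization of [polar2] in its first argument, hence trilinear if q is
    a cubic polynomial without constant term. *)
Definition polar3 (T : Type) (add : T -> T -> T) (q : T -> bool) u v w : bool :=
  polar2 add q u w (+) polar2 add q v w (+) polar2 add q (add u v) w.

Lemma addb_xorb b b' : b (+) b' = xorb b b'.
Proof. by case: b b' => [] []. Qed.

Ltac bool_ring lam :=
  move: (lam`_0 != 0) (lam`_1 != 0) (lam`_2 != 0)
        (lam`_3 != 0) (lam`_4 != 0) (lam`_5 != 0) => l0 l1 l2 l3 l4 l5;
  rewrite !addb_xorb; btauto.

Lemma cocycle_diag lam p : cocycle lam p p = cubic true lam p.
Proof. case: p => [[x y] z] /=; bool_ring lam. Qed.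

Lemma cocycle_comm lam p p' :
  cocycle lam p p' = polar2 addc (cubic true lam) p p' (+) cocycle lam p' p.
Proof.
case: p p' => [[x y] z] [[x' y'] z']; rewrite /polar2 /=; bool_ring lam.
Qed.

Lemma cocycle_assoc lam p p' p'' :
  cocycle lam (addc p p') p'' =
  cocycle lam p (addc p' p'') (+) cocycle lam p p' (+) cocycle lam p' p'' (+)
  polar3 addc (cubic true lam) p p' p''.
Proof.
case: p p' p'' => [[x y] z] [[x' y'] z'] [[x'' y''] z''].
rewrite /polar3 /polar2 /=; bool_ring lam.
Qed.

Lemma polar3_quadratic lam p p' p'' :
  polar3 addc (cubic false lam) p p' p'' = false.
Proof.
case: p p' p'' => [[x y] z] [[x' y'] z'] [[x'' y''] z''].
rewrite /polar3 /polar2 /=; bool_ring lam.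
Qed.

(** A period p would make the trilinear form of xyz vanish whenever one argument
    is p, but this form is nondegenerate. *)
Lemma cubic_no_period lam p :
  (forall p', cubic true lam (addc p' p) = cubic true lam p') ->
  p = (false, false, false).
Proof.
case: p => [[x y] z] per.
have [] : x = false /\ y = false /\ z = false; last by move=> -> [-> ->].
have := per (false, false, false); have := per (true, false, false).
have := per (false, true, false); have := per (true, true, false).
have := per (false, false, true); have := per (true, false, true).
have := per (false, true, true); have := per (true, true, true).
rewrite /=; case: x y z {per} => [] [] [];
move: (lam`_0 != 0) (lam`_1 != 0) (lam`_2 != 0)
        (lam`_3 != 0) (lam`_4 != 0) (lam`_5 != 0);
by do 6!case.
Qed.

End Cubic.

(** * Factor sets in terms of the weight function *)

Section QuarterWeights.
Variables (m : nat) (V : {vspace 'rV['F_2]_m}).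
Hypothesis evenV : doubly_even V.
Implicit Types (u v w : subvs_of V).

(** The square of a lift of v to the code loop is (-1) ^ [qform v]. *)
Definition qform v : bool := odd_quarter (vsval v).

Lemma cap_polar2 v w :
  odd (#|supp (vsval v) :&: supp (vsval w)| %/ 2) = polar2 +%R qform v w.
Proof. by rewrite (cap_half evenV) ?subvsP //. Qed.

Lemma cap_polar3 u v w :
  odd #|supp (vsval u) :&: supp (vsval v) :&: supp (vsval w)| =
  polar3 +%R qform u v w.
Proof.
rewrite (odd_cap3 evenV) ?subvsP // /polar3 -!cap_polar2.
by rewrite [vsval (u + v)]linearD.
Qed.

Section FactorSet.
Variable phi : factor_set V.

Lemma fs_polar2 v w : phi v w = polar2 +%R qform v w (+) phi w v.
Proof. by rewrite -cap_polar2 -fs_comm. Qed.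

Lemma fs_polar3 u v w :
  phi (u + v) w = phi u (v + w) (+) phi u v (+) phi v w (+) polar3 +%R qform u v w.
Proof. by rewrite -cap_polar3 -fs_assoc. Qed.

End FactorSet.

Section BuildFactorSet.
Variable phi : subvs_of V -> subvs_of V -> bool.
Hypothesis phi_diag : forall v, phi v v = qform v.
Hypothesis phi_comm : forall v w, phi v w = polar2 +%R qform v w (+) phi w v.
Hypothesis phi_0l : forall v, phi 0 v = false.
Hypothesis phi_0r : forall v, phi v 0 = false.
Hypothesis phi_assoc : forall u v w,
  phi (u + v) w = phi u (v + w) (+) phi u v (+) phi v w (+) polar3 +%R qform u v w.

Definition polar_factor_set : factor_set V.
Proof.
apply: (@FactorSet m V phi) => //.
  by move=> v w; rewrite cap_polar2 -phi_comm.
by move=> w u v; rewrite cap_polar3 -phi_assoc.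
Defined.
End BuildFactorSet.

End QuarterWeights.

(** * Isometric codes have isomorphic loops *)

Section Isometry.
Variables (m m' : nat) (V : {vspace 'rV['F_2]_m}) (V' : {vspace 'rV['F_2]_m'}).
Variables (evenV : doubly_even V) (evenV' : doubly_even V').
Variables (phi : factor_set V) (phi' : factor_set V').
Variable theta : subvs_of V -> subvs_of V'.
Hypothesis thetaD : {morph theta : u v / u + v}.
Hypothesis theta_bij : bijective theta.
Hypothesis theta_qform : forall v, qform (theta v) = qform v.

Let polar2_theta v w : polar2 +%R (@qform _ V') (theta v) (theta w) = polar2 +%R (@qform _ V) v w.
Proof. by rewrite /polar2 -thetaD !theta_qform. Qed.

Let polar3_theta u v w :
  polar3 +%R (@qform _ V') (theta u) (theta v) (theta w) = polar3 +%R (@qform _ V) u v w.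
Proof. by rewrite /polar3 -thetaD !polar2_theta. Qed.

(** Since theta respects the polarizations of q, phi and phi' o theta satisfy the
    same relations, so their sum d satisfies the homogeneous ones: it is a
    symmetric cocycle with zero diagonal. *)
Lemma isometry_isomorphic :
  loop_isomorphic (CodeLoop evenV phi) (CodeLoop evenV' phi').
Proof.
have theta0 : theta 0 = 0.
  by apply: (addrI (theta 0)); rewrite -thetaD !addr0.
pose d u v := phi u v (+) phi' (theta u) (theta v).
have [||||e dE] := @symmetric_cocycle_coboundary _ d.
- move=> u; rewrite /d !fs_diag; change (qform u (+) qform (theta u) = false).
  by rewrite theta_qform addbb.
- move=> u v; rewrite /d (fs_polar2 evenV) (fs_polar2 evenV') polar2_theta.
  by rewrite addbACA addbb.
- by move=> u; rewrite /d theta0 !fs_0l.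
- move=> w u v; rewrite /d !thetaD (fs_polar3 evenV) (fs_polar3 evenV').
  rewrite polar3_theta; move: (polar3 _ _ _ _ _) (phi _ _) (phi _ _) (phi _ _).
  by move: (phi' _ _) (phi' _ _) (phi' _ _) => [] [] [] [] [] [] [].
exists (fun x => (x.1 (+) e x.2, theta x.2)).
  case: theta_bij => theta' thetaK theta'K.
  exists (fun y => (y.1 (+) e (theta' y.2), theta' y.2)).
    by case=> s v /=; rewrite thetaK -addbA addbb addbF.
  by case=> s v /=; rewrite theta'K -addbA addbb addbF.
move=> [s v] [t w]; congr pair; last exact: thetaD.
change (s (+) t (+) phi v w (+) e (v + w) =
  s (+) e v (+) (t (+) e w) (+) phi' (theta v) (theta w)).
have := dE v w; rewrite /d.
move: (phi _ _) (phi' _ _) (e v) (e w) (e (v + w)) s t.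
by do 7!case.
Qed.

End Isometry.

(** * Frames *)

Section Profile.
Variable lam : 6.-tuple 'F_2.

Definition profile m (a b c : 'rV['F_2]_m) : Prop := forall p,
  (4 %| wt (comb a b c p))%N /\ odd_quarter (comb a b c p) = cubic true lam p.

Lemma addcA p p' p'' : addc p (addc p' p'') = addc (addc p p') p''.
Proof.
by case: p p' p'' => [[x y] z] [[x' y'] z'] [[x'' y''] z'']; rewrite /= !addbA.
Qed.

Lemma addcc p : addc p p = (false, false, false).
Proof. by case: p => [[x y] z]; rewrite /= !addbb. Qed.

Lemma addc0 p : addc p (false, false, false) = p.
Proof. by case: p => [[x y] z]; rewrite /= !addbF. Qed.

(** Linear independence follows from the values of q alone: a linear relation
    would be a period of the cubic. *)
Lemma profile_inj m (a b c : 'rV['F_2]_m) : profile a b c -> injective (comb a b c).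
Proof.
move=> prof p p' eq_pp'.
suff /(congr1 (addc p)) : addc p p' = (false, false, false).
  by rewrite addcA addcc addc0; case: p' {eq_pp'} => [[x y] z].
apply: (@cubic_no_period lam) => p''.
by rewrite -!(prof _).2 !combD eq_pp' addrr_F2 addr0.
Qed.

Definition frame m (V : {vspace 'rV['F_2]_m}) (a b c : 'rV['F_2]_m) : Prop :=
  [/\ [/\ a \in V, b \in V & c \in V],
      forall v, v \in V -> exists p, v = comb a b c p & profile a b c].

Section Frame.
Variables (m : nat) (V : {vspace 'rV['F_2]_m}) (a b c : 'rV['F_2]_m).
Hypothesis fr : frame V a b c.

Lemma frame_even : doubly_even V.
Proof. by case: fr => _ span prof v /span[p ->]; case: (prof p). Qed.

Lemma frame_coords (v : subvs_of V) : exists p, vsval v == comb a b c p.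
Proof. by case: fr => _ span _; have [p ->] := span _ (subvsP v); exists p. Qed.

Definition coord3 (v : subvs_of V) : coords := xchoose (frame_coords v).

Lemma coord3K v : comb a b c (coord3 v) = vsval v.
Proof. by have /eqP := xchooseP (frame_coords v). Qed.

Lemma coord3_unique v p : vsval v = comb a b c p -> coord3 v = p.
Proof. by have [_ _ /profile_inj inj] := fr => vE; apply: inj; rewrite coord3K. Qed.

Lemma coord3D u v : coord3 (u + v) = addc (coord3 u) (coord3 v).
Proof. by apply: coord3_unique; rewrite combD !coord3K [LHS]linearD. Qed.

Lemma coord3_0 : coord3 0 = (false, false, false).
Proof. by apply: coord3_unique; rewrite comb0 linear0. Qed.

Lemma qform_coord3 v : qform v = cubic true lam (coord3 v).
Proof. by have [_ _ /(_ (coord3 v))[_ <-]] := fr; rewrite coord3K. Qed.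

Lemma frame_factor_set : factor_set V.
Proof.
have p2 u v : polar2 +%R (@qform _ V) u v = polar2 addc (cubic true lam) (coord3 u) (coord3 v).
  by rewrite /polar2 !qform_coord3 coord3D.
have p3 u v w : polar3 +%R (@qform _ V) u v w =
    polar3 addc (cubic true lam) (coord3 u) (coord3 v) (coord3 w).
  by rewrite /polar3 !p2 coord3D.
apply: (@polar_factor_set _ _ frame_even (fun v w => cocycle lam (coord3 v) (coord3 w))).
- by move=> v; rewrite cocycle_diag qform_coord3.
- by move=> v w; rewrite p2 -cocycle_comm.
- by move=> v; rewrite coord3_0; case: (coord3 v) => [[x y] z]; rewrite /= !andbF.
- by move=> v; rewrite coord3_0; case: (coord3 v) => [[x y] z]; rewrite /= !andbF.
- by move=> u v w; rewrite p3 !coord3D -cocycle_assoc.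
Qed.

Lemma frame_dim : \dim V = 3.
Proof.
case: fr => [[aV bV cV] span /profile_inj inj].
have -> : V = <<[:: a; b; c]>>%VS.
  apply/eqP; rewrite eqEsubv; apply/andP; split; last first.
    by apply/span_subvP => v; rewrite !inE => /or3P[] /eqP->.
  apply/subvP => v /span[p ->].
  by apply: mem_comb; apply: memv_span; rewrite !inE eqxx ?orbT.
apply/eqP/(@freeP _ _ _ [tuple a; b; c]) => k.
rewrite !big_ord_recl big_ord0 /= addr0 !scaleF2 addrA => comb0k.
have : (k ord0 != 0, k (lift ord0 ord0) != 0,
        k (lift ord0 (lift ord0 ord0)) != 0) = (false, false, false) :> coords.
  by apply: inj; rewrite comb0.
case=> /negbFE/eqP k0 /negbFE/eqP k1 /negbFE/eqP k2 [[|[|[|//]]] lti].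
- by rewrite -k0; congr (k _); apply/val_inj.
- by rewrite -k1; congr (k _); apply/val_inj.
- by rewrite -k2; congr (k _); apply/val_inj.
Qed.

End Frame.

Lemma frames_isomorphic m m' (V : {vspace 'rV['F_2]_m}) (V' : {vspace 'rV['F_2]_m'})
    a b c a' b' c' (evenV : doubly_even V) (evenV' : doubly_even V')
    (phi : factor_set V) (phi' : factor_set V') :
  frame V a b c -> frame V' a' b' c' ->
  loop_isomorphic (CodeLoop evenV phi) (CodeLoop evenV' phi').
Proof.
move=> fr fr'.
have vec m1 (V1 : {vspace 'rV['F_2]_m1}) a1 b1 c1 p : frame V1 a1 b1 c1 ->
    vsval (vsproj V1 (comb a1 b1 c1 p)) = comb a1 b1 c1 p.
  by case=> [[aV bV cV] _ _]; rewrite vsprojK // mem_comb.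
pose theta v := vsproj V' (comb a' b' c' (coord3 fr v)).
pose theta' v := vsproj V (comb a b c (coord3 fr' v)).
have coord3_theta v : coord3 fr' (theta v) = coord3 fr v.
  by apply: coord3_unique; rewrite vec.
have coord3_theta' v : coord3 fr (theta' v) = coord3 fr' v.
  by apply: coord3_unique; rewrite vec.
apply: (@isometry_isomorphic _ _ _ _ evenV evenV' phi phi' theta).
- by move=> u v; rewrite /theta coord3D combD linearD.
- exists theta' => v; rewrite /theta' /theta.
    by rewrite coord3_theta coord3K vsvalK.
  by rewrite -/(theta' v) coord3_theta' coord3K vsvalK.
by move=> v; rewrite (qform_coord3 fr') (qform_coord3 fr) coord3_theta.
Qed.

End Profile.

(** * Squares, commutators and associators in a code loop *)

Section LoopSigns.
Variable L : code_loop.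
Implicit Types x y z a b c : L.

Definition sgn (s : bool) : L := (s, 0).

Definition q x : bool := qform x.2.

Let evenL : doubly_even (cl_code L) := cl_even (c := L).

Lemma loop_eq x y : x.1 = y.1 -> x.2 = y.2 -> x = y.
Proof. by case: x y => [s v] [t w] /= -> ->. Qed.

Lemma mulE x y : (x * y)%g = (x.1 (+) y.1 (+) cl_phi L x.2 y.2, x.2 + y.2) :> L.
Proof. by []. Qed.

Lemma sgn_mul s x : (sgn s * x)%g = (s (+) x.1, x.2) :> L.
Proof. by rewrite mulE /= fs_0l addbF add0r. Qed.

Lemma sgn_inj : injective sgn. Proof. by move=> s t []. Qed.

Lemma sgn_cancel s t x : (sgn s * x = sgn t * x)%g -> s = t.
Proof. by rewrite !sgn_mul => -[/addIb]. Qed.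

Lemma neg1_exp (k : 'F_2) : (cl_neg1 L ^+ k)%g = sgn (k != 0).
Proof. by case: k => [[|[|//]]] ltk. Qed.

Lemma squareE x : (x * x)%g = sgn (q x).
Proof.
by rewrite mulE addbb addFb addrr_F2 fs_diag.
Qed.

Lemma commE x y : [~ x, y]%g = sgn (polar2 +%R (@qform _ (cl_code L)) x.2 y.2).
Proof.
case: x y => [s v] [t w]; apply: loop_eq => /=; last first.
  change (v + (w + (v + w)) = 0).
  by rewrite (addrA w) (addrC w) addrrK_F2 addrr_F2.
change (s (+) cl_phi L v v (+) (t (+) cl_phi L w w (+) (s (+) t (+) cl_phi L v w)
  (+) cl_phi L w (v + w)) (+) cl_phi L v (w + (v + w)) =
  polar2 +%R (@qform _ (cl_code L)) v w).
rewrite (addrA w) (addrC w) addrrK_F2.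
have := fs_polar3 evenL (cl_phi L) w w v.
rewrite addrr_F2 fs_0l -cap_polar3 // setIid.
rewrite (negbTE (cap_even evenL (subvsP w) (subvsP v))) (addrC w v).
have := fs_polar2 evenL (cl_phi L) v w.
move: (polar2 _ _ _ _) => p2.
move: (cl_phi L v v) (cl_phi L w w) (cl_phi L v w) (cl_phi L w v) => b1 b2 b3 b4.
move: (cl_phi L w (v + w)) => b5.
by move: b1 b2 b3 b4 b5 p2 s t; do 8!case.
Qed.

Definition assoc_sign x y z : bool := polar3 +%R (@qform _ (cl_code L)) x.2 y.2 z.2.

Lemma assocE x y z : ((x * y) * z = sgn (assoc_sign x y z) * (x * (y * z)))%g.
Proof.
case: x y z => [s u] [t v] [r w]; rewrite sgn_mul.
apply: loop_eq; last by rewrite /= addrA.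
have := fs_polar3 evenL (cl_phi L) u v w.
rewrite /assoc_sign /=.
move: (polar3 _ _ _ _ _) => p3.
move: (cl_phi L (u + v) w) (cl_phi L u (v + w)) (cl_phi L u v) (cl_phi L v w).
by move=> b1 b2 b3 b4; move: b1 b2 b3 b4 s t r p3; do 8!case.
Qed.

Lemma assoc_sign_nonassociative x y z : assoc_sign x y z -> nonassociative L.
Proof.
move=> xyz assoc; have := assocE x y z.
rewrite xyz -assoc -{1}[(x * (y * z))%g]mul1g.
by move/(@sgn_cancel false true).
Qed.

Lemma nonassociative_assoc_sign :
  nonassociative L -> ~ forall x y z, assoc_sign x y z = false.
Proof.
by move=> nonassoc sgn0; apply: nonassoc => x y z; rewrite assocE sgn0 mul1g.
Qed.

Lemma characteristic_vectorP a b c (lam : 6.-tuple 'F_2) :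
  characteristic_vector a b c lam <->
  [/\ q a = (lam`_0 != 0), q b = (lam`_1 != 0) & q c = (lam`_2 != 0)] /\
  [/\ polar2 +%R (@qform _ (cl_code L)) a.2 b.2 = (lam`_3 != 0),
      polar2 +%R (@qform _ (cl_code L)) a.2 c.2 = (lam`_4 != 0) &
      polar2 +%R (@qform _ (cl_code L)) b.2 c.2 = (lam`_5 != 0)].
Proof.
rewrite /characteristic_vector !expg2 !squareE !commE !neg1_exp.
split=> [[[/sgn_inj-> /sgn_inj-> /sgn_inj->] [/sgn_inj-> /sgn_inj-> /sgn_inj->]] //|].
by move=> [[-> -> ->] [-> -> ->]].
Qed.

Definition monomial a b c (p : coords) : L :=
  let: (x, y, z) := p in
  ((if x then a else 1) * (if y then b else 1) * (if z then c else 1))%g.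

Lemma monomial_vec a b c p : (monomial a b c p).2 = comb a.2 b.2 c.2 p.
Proof. by case: p => [[x y] z] /=; congr (_ + _ + _); case: ifP. Qed.

Lemma generators_comb a b c : generators a b c ->
  forall x : L, exists p, x.2 = comb a.2 b.2 c.2 p.
Proof.
move=> gen x; pose S : {pred L} := [pred y : L | y.2 \in <<[:: a.2; b.2; c.2]>>%VS].
have SM : umagma_closed S.
  by split=> [|y z]; rewrite !inE ?rpred0 //; exact: rpredD.
apply: span3_comb; apply: (gen S) => //.
- by apply: memv_span; rewrite !inE eqxx.
- by apply: memv_span; rewrite !inE eqxx !orbT.
- by apply: memv_span; rewrite !inE eqxx !orbT.
Qed.

(** The lifts of a code vector differ by -1, which is generated too, as the
    associator of a, b and c. *)
Lemma comb_generators a b c :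
  (forall x : L, exists p, x.2 = comb a.2 b.2 c.2 p) -> assoc_sign a b c ->
  generators a b c.
Proof.
move=> span abc S [S1 SM] SV Sa Sb Sc.
have Smon p : monomial a b c p \in S.
  by case: p => [[x y] z]; rewrite !SM //; case: ifP.
have Sneg : sgn true \in S.
  suff -> : sgn true = (((a * b) * c) * (a * (b * c))^-1)%g.
    by rewrite SM ?SV // !SM.
  rewrite (assocE a b c) abc sgn_mul; case: (a * (b * c))%g => [s v].
  rewrite [RHS]mulE; apply: loop_eq => /=; last by rewrite addrr_F2.
  by case: s (cl_phi L v v) => [] [].
move=> x; have [p xp] := span x.
have -> : x = (sgn (x.1 (+) (monomial a b c p).1) * monomial a b c p)%g.
  rewrite sgn_mul; apply: loop_eq; last by rewrite monomial_vec.
  by rewrite /= -addbA addbb addbF.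
by case: (_ (+) _); rewrite ?SM // mul1g.
Qed.

End LoopSigns.

(** * Characteristic vectors and frames *)

Section CharacteristicFrame.
Variable lam : 6.-tuple 'F_2.

Lemma cubic_polar m (V : {vspace 'rV['F_2]_m}) (a b c : subvs_of V) p :
  qform a = (lam`_0 != 0) -> qform b = (lam`_1 != 0) -> qform c = (lam`_2 != 0) ->
  polar2 +%R (@qform _ V) a b = (lam`_3 != 0) ->
  polar2 +%R (@qform _ V) a c = (lam`_4 != 0) ->
  polar2 +%R (@qform _ V) b c = (lam`_5 != 0) ->
  qform (comb a b c p) = cubic (polar3 +%R (@qform _ V) a b c) lam p.
Proof.
have q0 : qform (0 : subvs_of V) = false.
  rewrite /qform linear0 /odd_quarter /wt (_ : supp 0 = set0) ?cards0 //.
  by apply/setP => i; rewrite !inE mxE eqxx.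
rewrite /cubic => <- <- <- <- <- <-; rewrite /polar3 /polar2.
case: p => [[[] []] []]; rewrite /= ?addr0 ?add0r ?q0 //;
  move: (qform a) (qform b) (qform c) (qform (a + b)) (qform (a + c)) (qform (b + c))
        (qform (a + b + c)); by do 7!case.
Qed.

(** If the generators associated, q would be quadratic on the code, and all
    associators would be trivial. *)
Lemma char_vector_frame (L : code_loop) :
  has_characteristic_vector L lam ->
  exists a b c : L, frame lam (cl_code L) (vsval a.2) (vsval b.2) (vsval c.2).
Proof.
case=> nonassoc _ [a [b [c [gen]]]].
move/characteristic_vectorP => [[qa qb qc] [qab qac qbc]].
have span := generators_comb gen.
have evenL := cl_even (c := L).
have qcomb p := @cubic_polar _ _ a.2 b.2 c.2 p qa qb qc qab qac qbc.
have abc : assoc_sign a b c = true.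
  case abc: (assoc_sign a b c) => //; case: (nonassociative_assoc_sign nonassoc).
  move=> x y z; rewrite /assoc_sign.
  have [p ->] := span x; have [p' ->] := span y; have [p'' ->] := span z.
  rewrite -(polar3_quadratic lam p p' p'') /polar3 /polar2 -!combD.
  by rewrite !qcomb -/(assoc_sign a b c) abc.
exists a, b, c; split; first by rewrite !subvsP.
  move=> v vV; have [p] := span (false, Subvs vV).
  by move/(congr1 vsval); rewrite raddf_comb => /= vE; exists p.
move=> p; rewrite -raddf_comb; split; first exact: (evenL _ (subvsP _)).
by rewrite -[LHS]/(qform _) qcomb -/(assoc_sign a b c) abc.
Qed.

Lemma frame_char_vector m (V : {vspace 'rV['F_2]_m}) a b c
    (evenV : doubly_even V) (phi : factor_set V) :
  frame lam V a b c -> has_characteristic_vector (CodeLoop evenV phi) lam.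
Proof.
move=> fr; have [[aV bV cV] span prof] := fr.
pose L := CodeLoop evenV phi.
pose x : L := (false, Subvs aV); pose y : L := (false, Subvs bV).
pose z : L := (false, Subvs cV).
have qcomb p : qform (comb x.2 y.2 z.2 p) = cubic true lam p.
  by rewrite /qform raddf_comb (prof p).2.
have /characteristic_vectorP char_xyz : characteristic_vector x y z lam.
  apply/characteristic_vectorP.
  have := qcomb (true, false, false); have := qcomb (false, true, false).
  have := qcomb (false, false, true); have := qcomb (true, true, false).
  have := qcomb (true, false, true); have := qcomb (false, true, true).
  rewrite /q /polar2 /= ?addr0 ?add0r => -> -> -> -> -> ->.
  rewrite !andbF !andbT !addbF.
  by split; split=> //; do 3!case: (_ != 0).
have xyz : assoc_sign x y z = true.
  have [[qx qy qz] [qxy qxz qyz]] := char_xyz.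
  have := cubic_polar (true, true, true) qx qy qz qxy qxz qyz.
  by rewrite qcomb /= !andbT => /addbI/esym.
split; first exact: assoc_sign_nonassociative xyz.
  exact: frame_dim fr.
exists x, y, z; split; last exact/characteristic_vectorP.
apply: comb_generators xyz => -[s v]; have [p vp] := span _ (subvsP v).
by exists p; apply/val_inj; rewrite [RHS]raddf_comb.
Qed.

End CharacteristicFrame.

(** * Isomorphisms preserve the weight function *)

Section Isomorphism.
Variables (L L' : code_loop) (f : L -> L').
Hypothesis f_bij : bijective f.
Hypothesis fM : {morph f : x y / (x * y)%g}.
Hypothesis nonassoc : nonassociative L.

Lemma iso1 : f 1%g = 1%g.
Proof.
have := fM 1%g 1%g; rewrite mul1g; case: (f 1%g) => [s v] ff.
have v0 : v = 0.
  by have /(congr1 (fun u => v + u)) := congr1 snd ff; rewrite /= addrA addrr_F2 add0r.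
have := congr1 fst ff; rewrite v0 /= fs_0l addbF addbb => ->.
by [].
Qed.

Lemma mul_cancelr (u x y : L') : (x * u)%g = (y * u)%g -> x = y.
Proof.
case: u x y => [r u] [s v] [t w] xu.
have vw : v = w by have /addIr := congr1 snd xu.
by have := congr1 fst xu; rewrite /= vw => /addIb/addIb ->.
Qed.

(** The element -1 is recognized as the only nontrivial associator. *)
Lemma iso_sgn s : f (sgn L s) = sgn L' s.
Proof.
case: s; last exact: iso1.
have [f' fK _] := f_bij.
apply/eqP/negPn/negP => /eqP neg_neq.
apply: (nonassociative_assoc_sign nonassoc) => x y z.
case xyz: (assoc_sign x y z) => //; case: neg_neq.
have := congr1 f (assocE x y z); rewrite xyz !fM assocE => /mul_cancelr <-.
case fxyz: (assoc_sign _ _ _) => //.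
have := congr1 f (assocE x y z); rewrite xyz !fM assocE fxyz => /mul_cancelr.
rewrite -[sgn L' false]/(1%g : L') -iso1.
by move/(can_inj fK).
Qed.

Lemma iso_q x : q (f x) = q x.
Proof. by apply: (@sgn_inj L'); rewrite -squareE -fM squareE iso_sgn. Qed.

Lemma iso_monomial a b c p :
  f (monomial a b c p) = monomial (f a) (f b) (f c) p.
Proof. by case: p => [[x y] z] /=; rewrite !fM; do 3!case: ifP; rewrite ?iso1. Qed.

Lemma iso_profile lam (a b c : L) :
  profile lam (vsval a.2) (vsval b.2) (vsval c.2) ->
  profile lam (vsval (f a).2) (vsval (f b).2) (vsval (f c).2).
Proof.
move=> prof p; rewrite -(prof p).2 -!raddf_comb -!monomial_vec -iso_monomial.
split; last exact: iso_q.
by apply: (cl_even (c := L')); apply: subvsP.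
Qed.

End Isomorphism.

(** * Lower bounds on the degree *)

Lemma F2_wtE m (v : 'rV['F_2]_m) : wt v = (\sum_i (v ord0 i != 0%R : nat))%N.
Proof.
rewrite /wt -sum1_card big_mkcond; apply: eq_bigr => i _.
by rewrite inE; case: (_ != 0).
Qed.

Definition dot (p p' : coords) : bool :=
  let: (x, y, z) := p in let: (x', y', z') := p' in
  x && x' (+) y && y' (+) z && z'.

Lemma wt_comb m (a b c : 'rV['F_2]_m) p :
  wt (comb a b c p) =
  (\sum_i (dot p (a ord0 i != 0%R, b ord0 i != 0%R, c ord0 i != 0%R)))%N.
Proof.
rewrite F2_wtE; apply: eq_bigr => i _; congr nat_of_bool.
case: p => [[x y] z]; rewrite /= !mxE !F2_addb.
by congr (_ (+) _ (+) _); case: ifP; rewrite ?mxE.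
Qed.

(** The numbers of columns, in terms of the weights. A column r contributes 4 to
    the sum of all seven weights, and it contributes 2 to the sum of the weights of
    the three combinations that do not see a given column s, and 2 to that of the
    four that do, except that s itself contributes 0 and 4. *)
Definition weight_inequalities n (w : coords -> nat) : Prop :=
  let a := w (true, false, false) in let b := w (false, true, false) in
  let c := w (false, false, true) in let ab := w (true, true, false) in
  let ac := w (true, false, true) in let bc := w (false, true, true) in
  let abc := w (true, true, true) in
  [/\ (a + b + c + ab + ac + bc + abc <= n)%N,
  (b + c + bc <= a + ab + ac + abc)%N,
  (a + c + ac <= b + ab + bc + abc)%N,
  (a + b + ab <= c + ac + bc + abc)%N &
  [/\ (c + ab + abc <= a + b + ac + bc)%N,
  (b + ac + abc <= a + c + ab + bc)%N,
  (a + bc + abc <= b + c + ab + ac)%N &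
  (ab + ac + bc <= a + b + c + abc)%N]].

Lemma wt_inequalities m (a b c : 'rV['F_2]_m) :
  weight_inequalities (4 * m) (fun p => wt (comb a b c p)).
Proof.
rewrite /weight_inequalities !wt_comb -!big_split /=; split; last split;
  try by apply: leq_sum => i _;
  move: (a _ _ != 0) (b _ _ != 0) (c _ _ != 0) => [] [] [].
rewrite mulnC -[m in (_ <= m * _)%N]card_ord -sum_nat_const.
apply: leq_sum => i _.
by move: (a _ _ != 0) (b _ _ != 0) (c _ _ != 0) => [] [] [].
Qed.

Lemma weight_inequalities_div4 n w k : (forall p, w p = 4 * k p)%N ->
  weight_inequalities (4 * n) w -> weight_inequalities n k.
Proof. by move=> wE; rewrite /weight_inequalities !wE -!mulnDr !leq_mul2l. Qed.

Lemma profile_quarters lam m (a b c : 'rV['F_2]_m) : profile lam a b c ->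
  exists2 k : coords -> nat, weight_inequalities m k &
    forall p, odd (k p) = cubic true lam p.
Proof.
move=> prof; exists (fun p => (wt (comb a b c p) %/ 4)%N); last first.
  by move=> p; rewrite -(prof p).2.
apply: weight_inequalities_div4 (wt_inequalities a b c) => p.
by rewrite mulnC divnK // (prof p).1.
Qed.

(** * Reduction to frames, and the frames of the given codes *)

Lemma frame_minimal_representation lam m (V : {vspace 'rV['F_2]_m}) a b c :
  frame lam V a b c ->
  (forall m' (a' b' c' : 'rV['F_2]_m'), profile lam a' b' c' -> (m <= m')%N) ->
  minimal_representation_of lam V.
Proof.
move=> fr le_m; pose phi := frame_factor_set fr; have evenV := frame_even fr.
split; first by exists (CodeLoop evenV phi); exact: frame_char_vector fr.
move=> L charL; have [x [y [z frL]]] := char_vector_frame charL.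
split.
  exists evenV, phi; case: L charL x y z frL => n W evenW psi _ x y z frL.
  exact: frames_isomorphic frL fr.
move=> m' V' [evenV' [phi' [f f_bij fM]]].
have [nonassoc _ _] := charL; have [_ _ prof] := frL.
exact: le_m (iso_profile f_bij fM nonassoc prof).
Qed.

Definition count_comb m (s1 s2 s3 : seq nat) (p : coords) : nat :=
  count (fun i => dot p (i \in s1, i \in s2, i \in s3)) (iota 1 m).

Lemma wt_comb_subsets m s1 s2 s3 p :
  wt (comb (vec_of_subset m s1) (vec_of_subset m s2) (vec_of_subset m s3) p) =
  count_comb m s1 s2 s3 p.
Proof.
have memE s i : (vec_of_subset m s ord0 i != 0) = (i.+1 \in s).
  by rewrite mxE; case: (_ \in s).
rewrite wt_comb /count_comb -sum1_count [RHS]big_mkcond /=.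
have -> : iota 1 m = [seq i.+1 | i <- index_iota 0 m].
  by rewrite /index_iota subn0 -[1%N]addn0 iotaDl.
rewrite big_map big_mkord; apply: eq_bigr => i _.
by rewrite !memE; case: (dot _ _).
Qed.

(** Product of a matrix and a vector: p1, p2 and p3 are the columns of the matrix. *)
Definition mulc (p1 p2 p3 p : coords) : coords :=
  let: (x, y, z) := p in
  addc (addc (if x then p1 else (false, false, false))
             (if y then p2 else (false, false, false)))
       (if z then p3 else (false, false, false)).

Lemma comb_comb (U : lmodType 'F_2) (a b c : U) p1 p2 p3 p :
  comb (comb a b c p1) (comb a b c p2) (comb a b c p3) p =
  comb a b c (mulc p1 p2 p3 p).
Proof.
case: p => [[x y] z]; rewrite {1}/comb /mulc !combD -(comb0 a b c).
by congr (_ + _ + _); case: ifP.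
Qed.

Definition all_coords (P : pred coords) : bool :=
  [&& P (false, false, false), P (true, false, false), P (false, true, false),
      P (true, true, false), P (false, false, true), P (true, false, true),
      P (false, true, true) & P (true, true, true)].

Lemma all_coordsP P : all_coords P -> forall p, P p.
Proof.
by do 7!case/andP=> ?; move=> ? [[[] []] []].
Qed.

(** The frame vectors are the combinations p1, p2 and p3 of the listed generators;
    q1, q2 and q3 are the columns of the inverse change of basis. *)
Lemma subsets_frame lam m s1 s2 s3 p1 p2 p3 q1 q2 q3
    (gen := comb (vec_of_subset m s1) (vec_of_subset m s2) (vec_of_subset m s3)) :
  all_coords (fun p => mulc p1 p2 p3 (mulc q1 q2 q3 p) == p) ->
  all_coords (fun p => let w := count_comb m s1 s2 s3 (mulc p1 p2 p3 p) in
    (4 %| w)%N && (odd (w %/ 4) == cubic true lam p)) ->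
  frame lam (code_span m [:: s1; s2; s3]) (gen p1) (gen p2) (gen p3).
Proof.
move=> /all_coordsP mulK /all_coordsP weights.
split.
- by split; apply: mem_comb; apply: memv_span; rewrite !inE eqxx ?orbT.
- move=> v /span3_comb[p ->]; exists (mulc q1 q2 q3 p).
  by rewrite comb_comb (eqP (mulK p)).
move=> p; rewrite comb_comb /odd_quarter wt_comb_subsets.
by have /andP[-> /eqP ->] := weights p.
Qed.

(** The bounds are left to integer arithmetic. Here is why they hold. Let k_p be a
    quarter of the weight of the combination p, so that the number n_r of columns
    r is the sum of the four k_p with p.r = 1 minus the sum of the three others.
    The k_p sum to an odd number because the cubic has odd top coefficient, so
    every n_r is odd. Then every k_p is positive, and even ones are at least 2, so
    the degree is at least 7 plus the number of zeros of the cubic at nonzero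
    points: there are 0, 6 and 4 zeros for 111111, 000000 and 000111.

    For 110000 and 100000, with 2 and 4 zeros, put n_r = 1 + 2 e_r. The sum of the
    four e_r with p.r = 1 is 2 (k_p - 1), which is even, and the zeros are the p
    for which this sum is 2 modulo 4. A degree below 17 means that the sum of all
    e_r is at most 4. As the sums of e off the lines of the Fano plane are even, e
    is supported modulo 2 on the empty set, a line, the complement of a line or
    the whole plane, so the possible e are few: 0, 2 or 4 at one point, 2 at two
    points, 1 on a line, or 1 off a line. The resulting sets of zeros are empty,
    the complement of a line, or all points but one. The set of zeros for 110000
    has two points, and that for 100000 contains the line of b, c and b + c. *)
Ltac degree_bound :=
  let k := fresh "k" in let ineq := fresh "ineq" in let odd_k := fresh "odd_k" in
  move=> m' a b c /profile_quarters[k ineq odd_k];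
  have := odd_k (true, false, false); have := odd_k (false, true, false);
  have := odd_k (false, false, true); have := odd_k (true, true, false);
  have := odd_k (true, false, true); have := odd_k (false, true, true);
  have := odd_k (true, true, true);
  rewrite /cubic /=;
  move: ineq; rewrite /weight_inequalities;
  move: (k (true, false, false)) (k (false, true, false)) (k (false, false, true))
    (k (true, true, false)) (k (true, false, true)) (k (false, true, true))
    (k (true, true, true)) => k1 k2 k3 k4 k5 k6 k7 [? ? ? ? [? ? ? ?]] ? ? ? ? ? ? ?; lia.

Lemma degree_ge_111111 m (a b c : 'rV['F_2]_m) :
  profile [tuple 1; 1; 1; 1; 1; 1] a b c -> (7 <= m)%N.
Proof. move: m a b c; degree_bound. Qed.
Lemma degree_ge_000000 m (a b c : 'rV['F_2]_m) :
  profile [tuple 0; 0; 0; 0; 0; 0] a b c -> (13 <= m)%N.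
Proof. move: m a b c; degree_bound. Qed.
Lemma degree_ge_000111 m (a b c : 'rV['F_2]_m) :
  profile [tuple 0; 0; 0; 1; 1; 1] a b c -> (11 <= m)%N.
Proof. move: m a b c; degree_bound. Qed.
Lemma degree_ge_110000 m (a b c : 'rV['F_2]_m) :
  profile [tuple 1; 1; 0; 0; 0; 0] a b c -> (17 <= m)%N.
Proof. move: m a b c; degree_bound. Qed.
Lemma degree_ge_100000 m (a b c : 'rV['F_2]_m) :
  profile [tuple 1; 0; 0; 0; 0; 0] a b c -> (17 <= m)%N.
Proof. move: m a b c; degree_bound. Qed.

Theorem theorem3 :
  [/\ minimal_representation_of [tuple 1; 1; 1; 1; 1; 1]%R
        (code_span 7
          [:: [:: 1; 2; 3; 4];
              [:: 1; 2; 5; 6];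
              [:: 1; 3; 5; 7]]%N),
      minimal_representation_of [tuple 0; 0; 0; 0; 0; 0]%R
        (code_span 13
          [:: [:: 1; 2; 3; 4; 5; 6; 7; 8];
              [:: 1; 2; 3; 4; 9; 10; 11; 12];
              [:: 1; 5; 6; 7; 9; 10; 11; 13]]%N),
      minimal_representation_of [tuple 0; 0; 0; 1; 1; 1]%R
        (code_span 11
          [:: [:: 1; 2; 3; 4; 5; 6; 7; 8];
              [:: 1; 2; 3; 4; 5; 6; 9; 10];
              [:: 1; 2; 3; 4; 5; 7; 9; 11]]%N),
      minimal_representation_of [tuple 1; 1; 0; 0; 0; 0]%R
        (code_span 17
          [:: [:: 1; 2; 3; 4];
              [:: 1; 2; 5; 6; 7; 8; 9; 10; 11; 12; 13; 14];
              [:: 1; 3; 5; 6; 7; 8; 9; 10; 11; 15; 16; 17]]%N) &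
      minimal_representation_of [tuple 1; 0; 0; 0; 0; 0]%R
        (code_span 17
          [:: [:: 1; 2; 3; 4; 5; 6; 7; 8; 9; 10; 11; 12];
              [:: 1; 2; 3; 4; 5; 6; 7; 8; 13; 14; 15; 16];
              [:: 1; 2; 3; 4; 5; 9; 10; 11; 13; 14; 15; 17]]%N)].
Proof.
pose e1 : coords := (true, false, false).
pose e2 : coords := (false, true, false).
pose e3 : coords := (false, false, true).
split.
- apply: frame_minimal_representation degree_ge_111111.
  by apply: (@subsets_frame _ _ _ _ _ e1 e2 e3 e1 e2 e3); vm_compute.
- apply: frame_minimal_representation degree_ge_000000.
  by apply: (@subsets_frame _ _ _ _ _ e1 e2 e3 e1 e2 e3); vm_compute.
- apply: frame_minimal_representation degree_ge_000111.
  by apply: (@subsets_frame _ _ _ _ _ e1 e2 e3 e1 e2 e3); vm_compute.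
(* The cubic of 110000 vanishes at exactly two nonzero points, c and a + b. In
   the fourth code these are v2 + v3 and v1 + v2 + v3, whence c = v2 + v3,
   a = v2 and b = v1 + v3. *)
- apply: frame_minimal_representation degree_ge_110000.
  by apply: (@subsets_frame _ _ _ _ _ e2 (true, false, true) (false, true, true)
               (true, true, true) e1 (true, false, true)); vm_compute.
(* The cubic of 100000 is 1 exactly at a, a + b and a + c, and in the fifth code
   at v1, v2 and v3, whence a = v1, b = v1 + v2 and c = v1 + v3. *)
- apply: frame_minimal_representation degree_ge_100000.
  by apply: (@subsets_frame _ _ _ _ _ e1 (true, true, false) (true, false, true)
               e1 (true, true, false) (true, false, true)); vm_compute.
Qed.
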